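(* Let $A \subset \mathbb{R}$ be finite. Then $$|A(A+A)| \gtrsim |A|^{\frac{3}{2}+\frac{5}{242}}.$$
   Context: $A+A=\{a+b: a,b\in A\}$ and $A(A+A)=\{a(b+c): a,b,c\in A\}$. Notation: $X \ll Y$ (equivalently $Y\gg X$) means $X\le cY$ for an absolute constant $c>0$. $X \gtrsim Y$ means there is an absolute constant $c>0$ such that $X \gg Y/(\log X)^c$. Logarithms are base 2. *)

(* Defs.v *)
From HB Require Import structures.
From mathcomp Require Import all_boot all_order all_algebra.
From mathcomp Require Import finmap.
From mathcomp Require Import reals exp.
Set Implicit Arguments. Unset Strict Implicit. Unset Printing Implicit Defensive.
Import Order.TTheory GRing.Theory Num.Theory.
Local Open Scope ring_scope.
Local Open Scope fset_scope.

Definition sumset (R : realType) (A : {fset R}) : {fset R} :=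
  [fset (a + b)%R | a in A, b in A].

Definition prod_sumset (R : realType) (A : {fset R}) : {fset R} :=
  [fset (a * s)%R | a in A, s in sumset A].

Definition log2 (R : realType) (x : R) : R := ln x / ln 2.

(* Main.v *)
(* Let n = |A|, X = |A(A+A)|, and let all elements of A be positive.  Counting
   solutions of a(b+c) = a'(b'+c') shows that, unless X is much larger than n^(3/2),
   A has multiplicative energy close to n^3: the additive part of the count is
   controlled by the collinear triples of A x A, that is, by Szemeredi-Trotter.  Hence
   a popular set P of ratios dilates A onto many elements of a large subset B of A, and
   Szemeredi-Trotter bounds the third moment of the representation function f of
   B - B.  It also bounds the third moment of the representation function g of S - S
   for S = A + A, since every element of S is w / a with w in A(A+A) in n ways.
   Let e(z) be the number of solutions of u + c = v + c' with u, v in the meet of B and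
   B + z, and with c, c' in B.  By Katz-Koester f(z)^2 |B|^2 <= g(z) e(z), and the
   sum of e is at most the sum of f^3; Cauchy-Schwarz and Hoelder then give
   (|B| sum f^2)^6 <= (sum f^3)^5 (sum g^3).  As |B|^4 <= X sum f^2, this yields
   n^137 << X^90 (log X)^82, and 137/90 = 3/2 + 1/45 > 3/2 + 5/242.
   Only increasing lines and Cartesian products occur, so Szemeredi-Trotter follows
   from cutting the product into a grid of cells: an increasing line meets
   fewer than 2r cells of an r x r grid. *)
Require Import Defs.
From HB Require Import structures.
From mathcomp Require Import all_boot all_order all_algebra.
From mathcomp Require Import finmap.
From mathcomp Require Import boolp reals exp.
From mathcomp Require Import zify ring lra.
Set Implicit Arguments.
Unset Strict Implicit.
Unset Printing Implicit Defensive.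
Import Order.TTheory GRing.Theory Num.Theory.
Local Open Scope fset_scope.
Local Open Scope ring_scope.

(** * Incidences on Cartesian products *)

Lemma count_sum (T : Type) (P : pred T) (s : seq T) :
  count P s = (\sum_(x <- s) P x)%N.
Proof. by rewrite -sum1_count big_mkcond; apply: eq_bigr => x _; case: (P x). Qed.

Lemma sum_eq_mem (T : choiceType) (A : {fset T}) (x : T) :
  (\sum_(y <- A) (y == x) = (x \in A))%N.
Proof. by rewrite -count_sum (count_uniq_mem _ (fset_uniq A)). Qed.

Lemma sum_le1 (T : eqType) (s : seq T) (P : pred T) : uniq s ->
  {in s &, forall x y, P x -> P y -> x = y} -> (\sum_(x <- s) P x <= 1)%N.
Proof.
move=> us uP; rewrite -count_sum -size_filter.
case e: (filter P s) => [|x [|y t]] //.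
have: uniq (filter P s) by rewrite filter_uniq.
have: x \in filter P s by rewrite e mem_head.
have: y \in filter P s by rewrite e !inE eqxx orbT.
rewrite !mem_filter => /andP[Py ys] /andP[Px xs].
by rewrite e (uP x y) //= mem_head.
Qed.

Lemma sum_mem_le (T T' : choiceType) (A : {fset T}) (B : {fset T'}) (g : T -> T') :
  {in A &, injective g} -> (\sum_(a <- A) (g a \in B) <= #|` B|)%N.
Proof.
move=> gI; under eq_bigr => a _ do rewrite -sum_eq_mem.
rewrite exchange_big card_fset_sum1 /=; apply: leq_sum => b _.
by apply: sum_le1 => // x y xA yA /eqP e1 /eqP e2; apply: gI; rewrite // -e1 -e2.
Qed.

Lemma card_filter (T : choiceType) (A : {fset T}) (P : pred T) :
  #|` [fset x in A | P x]| = (\sum_(x <- A) P x)%N.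
Proof.
rewrite card_fset_sum1 big_fset /= big_mkcond /=.
by apply: eq_bigr => x _; case: (P x).
Qed.

(** * Cutting a finite set into blocks of consecutive elements *)

Section Slabs.
Variables (R : realDomainType).
Implicit Types (U V : {fset R}) (x y : R).

Definition rank U x : nat := count (fun u => u < x) U.

Lemma rank_le U x y : x <= y -> (rank U x <= rank U y)%N.
Proof. by move=> xy; apply: sub_count => u /= ux; apply: lt_le_trans xy. Qed.

Lemma rank_lt U x y : x \in U -> x < y -> (rank U x < rank U y)%N.
Proof.
move=> xU xy; rewrite /rank !count_sum.
rewrite !(big_fsetD1 x xU) /= ltxx xy add0n add1n ltnS.
apply: leq_sum => u _; case ux: (u < x) => //.
by rewrite (lt_trans ux xy).
Qed.

Lemma rank_inj U : {in U &, injective (rank U)}.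
Proof.
move=> x y xU yU e; case: (ltgtP x y) => // h.
  by have := rank_lt xU h; rewrite e ltnn.
by have := rank_lt yU h; rewrite e ltnn.
Qed.

Lemma rank_bound U x : x \in U -> (rank U x < #|` U|)%N.
Proof.
move=> xU; rewrite card_fset_sum1 /rank count_sum.
rewrite !(big_fsetD1 x xU) /= ltxx add0n add1n ltnS.
by apply: leq_sum => u _; case: (_ < _).
Qed.

(** With [U] sorted and cut into consecutive blocks of [w] elements, this is the index of the block
    at [x]. Using [rank] avoids an explicit sorted enumeration. *)
Definition slab U (w : nat) x : nat := (rank U x %/ w)%N.

(** The elements of one slab have distinct ranks in an interval of length [w], so each [x] shares
    its slab with at most [w] elements. *)
Lemma slab_pairs U w : (0 < w)%N ->
  (\sum_(x <- U) \sum_(y <- U) (slab U w x == slab U w y) <= #|` U| * w)%N.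
Proof.
move=> w0; rewrite card_fset_sum1 big_distrl /=.
apply: leq_sum => x _; rewrite mul1n -count_sum -size_filter.
rewrite -(size_map (rank U)) -[leqRHS](size_iota (slab U w x * w) w).
apply: uniq_leq_size.
  rewrite map_inj_in_uniq ?filter_uniq ?fset_uniq //.
  by move=> a b; rewrite !mem_filter => /andP[_ aU] /andP[_ bU]; apply: rank_inj.
move=> k /mapP[y]; rewrite mem_filter => /andP[/eqP e yU] ->.
by rewrite e mem_iota /slab leq_divM /= addnC -mulSn ltn_ceil.
Qed.

End Slabs.

(* 2c <= 1 + c^2 on every fibre of [key]. *)
Lemma fibre_bound (T : choiceType) (A : {fset T}) (key : T -> nat) (K : nat) :
  {in A, forall x, key x < K}%N ->
  (2 * #|` A| <= K + \sum_(x <- A) \sum_(y <- A) (key x == key y))%N.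
Proof.
move=> kK; pose c (k : 'I_K) := (\sum_(x <- A) (key x == k))%N.
have -> : #|` A| = (\sum_(k < K) c k)%N.
  rewrite card_fset_sum1 exchange_big /= big_seq [RHS]big_seq.
  apply: eq_bigr => x xA; rewrite (bigD1 (Ordinal (kK x xA))) //= eqxx.
  by rewrite big1 ?addn0 // => k /eqP nk; case: eqP => // e; case: nk; apply: val_inj.
have -> : (\sum_(x <- A) \sum_(y <- A) (key x == key y) = \sum_(k < K) c k ^ 2)%N.
  have sq k : (c k ^ 2 = \sum_(x <- A) \sum_(y <- A) (key x == k) * (key y == k))%N.
    rewrite -mulnn /c big_distrl /=; apply: eq_bigr => x _.
    by rewrite big_distrr.
  under [RHS]eq_bigr => k _ do rewrite sq.
  rewrite [RHS]exchange_big /= big_seq [RHS]big_seq; apply: eq_bigr => x xA.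
  rewrite [RHS]exchange_big /=; apply: eq_bigr => y yA.
  rewrite (bigD1 (Ordinal (kK x xA))) //= eqxx mul1n eq_sym.
  rewrite big1 ?addn0 // => k /eqP nk; case: eqP => // e; case: nk; exact: val_inj.
have -> : (K + \sum_(k < K) c k ^ 2 = \sum_(k < K) (1 + c k ^ 2))%N.
  by rewrite big_split /= sum1_card card_ord.
rewrite big_distrr /=.
by apply: leq_sum => k _; nia.
Qed.

(** * Grid cells and a Szemeredi-Trotter bound for increasing lines *)

Section Incidences.
Variable (R : realFieldType).
Implicit Types (U V : {fset R}) (L : {fset R * R}).

Definition line (l : R * R) (u : R) : R := l.1 * u + l.2.

Definition inc U V (l : R * R) : nat := (\sum_(u <- U) (line l u \in V))%N.

(* An increasing line meets the cells of the grid along a chain, so the sum of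
   the two slab indices separates the cells it meets. *)
Lemma line_cells U V (l : R * R) (w1 w2 r : nat) : 0 < l.1 ->
  (#|` U| <= r * w1)%N -> (#|` V| <= r * w2)%N ->
  (inc U V l <= 2 * r + \sum_(u <- U) \sum_(u' <- U)
     [&& u != u', line l u \in V, line l u' \in V,
      slab U w1 u == slab U w1 u' & slab V w2 (line l u) == slab V w2 (line l u')])%N.
Proof.
move=> l0 hU hV; set f := line l.
pose A := [fset u in U | f u \in V].
pose key u := (slab U w1 u + slab V w2 (f u))%N.
have incE : inc U V l = #|` A|.
  by rewrite /A card_filter.
have keyK : {in A, forall u, key u < 2 * r}%N.
  move=> u; rewrite !inE /= => /andP[uU vV].
  have w1_gt0 : (0 < w1)%N by have := rank_bound uU; rewrite lt0n; apply: contraTneq => w10; by move: hU; rewrite w10 muln0 leqn0 => /eqP ->.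
  have w2_gt0 : (0 < w2)%N by have := rank_bound vV; rewrite lt0n; apply: contraTneq => w20; by move: hV; rewrite w20 muln0 leqn0 => /eqP ->.
  have : (slab U w1 u < r)%N by rewrite ltn_divLR // (leq_trans (rank_bound uU)).
  have : (slab V w2 (f u) < r)%N by rewrite ltn_divLR // (leq_trans (rank_bound vV)).
  rewrite /key; lia.
have fmono x y : x <= y -> f x <= f y by move=> xy; rewrite /f /line lerD2r ler_pM2l.
have keyE x y : (key x == key y) =
    (slab U w1 x == slab U w1 y) && (slab V w2 (f x) == slab V w2 (f y)).
  wlog xy : x y / x <= y.
    move=> h; case/orP: (le_total x y) => /h // e.
    by rewrite eq_sym e; congr (_ && _); apply: eq_sym.
  have h1 : (slab U w1 x <= slab U w1 y)%N by apply/leq_div2r/rank_le.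
  have h2 : (slab V w2 (f x) <= slab V w2 (f y))%N by apply/leq_div2r/rank_le/fmono.
  by rewrite /key; lia.
have := fibre_bound keyK; rewrite incE.
(* The diagonal contributes [#|A|], which cancels one of the two copies of [#|A|] in
   [fibre_bound]. *)
have -> : (\sum_(x <- A) \sum_(y <- A) (key x == key y) =
   #|` A| + \sum_(x <- A) \sum_(y <- A) ((x != y) && (key x == key y)))%N.
  rewrite card_fset_sum1 -big_split /= big_seq [RHS]big_seq.
  apply: eq_bigr => x xA; rewrite (big_fsetD1 x xA) /= eqxx.
  rewrite [in RHS](big_fsetD1 x xA) /= eqxx add0n; congr addn.
  by rewrite big_seq [RHS]big_seq; apply: eq_bigr => y; rewrite !inE eq_sym => /andP[-> _].
have -> : (\sum_(x <- A) \sum_(y <- A) ((x != y) && (key x == key y)) =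
  \sum_(u <- U) \sum_(u' <- U)
     [&& u != u', f u \in V, f u' \in V,
      slab U w1 u == slab U w1 u' & slab V w2 (f u) == slab V w2 (f u')])%N.
  rewrite big_fset /= big_mkcond /=; apply: eq_bigr => x _.
  case: (f x \in V); last by rewrite big1 // => y _; rewrite andbF.
  rewrite big_fset /= big_mkcond /=; apply: eq_bigr => y _.
  by case: (f y \in V); rewrite ?andbF // keyE.
lia.
Qed.

(** Two points with distinct abscissae lie on at most one line, so the sum over all lines is at most
    the number of pairs of points of the grid that share a cell. *)
Lemma cell_pairs U V (L : seq (R * R)) (w1 w2 : nat) : uniq L ->
  (0 < w1)%N -> (0 < w2)%N ->
  (\sum_(l <- L) \sum_(u <- U) \sum_(u' <- U)
     [&& u != u', line l u \in V, line l u' \in V,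
      slab U w1 u == slab U w1 u' & slab V w2 (line l u) == slab V w2 (line l u')]
   <= (#|` U| * w1) * (#|` V| * w2))%N.
Proof.
move=> uL w1_gt0 w2_gt0.
apply: (@leq_trans (\sum_(l <- L) \sum_(u <- U) \sum_(u' <- U) \sum_(v <- V) \sum_(v' <- V)
  ((slab U w1 u == slab U w1 u') * ((slab V w2 v == slab V w2 v') *
   [&& u != u', line l u == v & line l u' == v']))))%N.
  apply: leq_sum => l _; apply: leq_sum => u _; apply: leq_sum => u' _.
  case c: [&& _, _, _, _ & _] => //.
  move/and5P: c => [nu vV v'V /eqP su /eqP sv].
  by rewrite (big_fsetD1 _ vV) /= (big_fsetD1 _ v'V) /= su sv nu !eqxx.
apply: leq_trans (leq_mul (slab_pairs U w1_gt0) (slab_pairs V w2_gt0)).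
rewrite exchange_big /= big_distrl /=; apply: leq_sum => u _.
rewrite exchange_big /= big_distrl /=; apply: leq_sum => u' _.
rewrite exchange_big /= big_distrr /=; apply: leq_sum => v _.
rewrite exchange_big /= big_distrr /=; apply: leq_sum => v' _.
rewrite -big_distrr leq_mul2l -big_distrr /=; apply/orP; right.
rewrite -[leqRHS]muln1 leq_mul2l; apply/orP; right.
apply: sum_le1 => // -[a b] [c d] _ _ /and3P[nu /eqP /= e1 /eqP /= e2] /and3P[_ /eqP e3 /eqP e4].
rewrite /line /= in e1 e2 e3 e4.
have ac : a = c.
  apply: (mulIf (_ : u - u' != 0)); first by rewrite subr_eq0.
  by lra.
by congr pair => //; move: e1 e3; rewrite ac; lra.
Qed.

(** Sum [line_cells] over the lines and bound the pairs in common cells by [cell_pairs]. The factor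
    [r ^ 2] clears the division in the slab widths. *)
Lemma incidence_bound U V (L : seq (R * R)) (r : nat) : uniq L ->
  {in L, forall l, 0 < l.1} -> (0 < r)%N -> (r <= #|` U|)%N -> (r <= #|` V|)%N ->
  (r ^ 2 * \sum_(l <- L) inc U V l <= 2 * r ^ 3 * size L + 4 * #|` U| ^ 2 * #|` V| ^ 2)%N.
Proof.
move=> uL L0 r0 rU rV.
(* The successor makes [r] slabs cover the set; as [r] is at most its size, this at most doubles
   [r * w1] and [r * w2]. *)
pose w1 := (#|` U| %/ r).+1; pose w2 := (#|` V| %/ r).+1.
have hU : (#|` U| <= r * w1)%N by rewrite mulnC ltnW // ltn_ceil.
have hV : (#|` V| <= r * w2)%N by rewrite mulnC ltnW // ltn_ceil.
have hU2 : (r * w1 <= 2 * #|` U|)%N.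
  by rewrite /w1 mulnS mulnC; have := leq_divM #|` U| r; lia.
have hV2 : (r * w2 <= 2 * #|` V|)%N.
  by rewrite /w2 mulnS mulnC; have := leq_divM #|` V| r; lia.
have : (\sum_(l <- L) inc U V l <= 2 * r * size L + (#|` U| * w1) * (#|` V| * w2))%N.
  apply: leq_trans (leq_add (leqnn _) (cell_pairs U V uL (ltn0Sn _) (ltn0Sn _))).
  rewrite -sum1_size big_distrr -big_split /= big_seq [leqRHS]big_seq.
  by apply: leq_sum => l lL; rewrite muln1; apply: line_cells => //; apply: L0.
move=> hI; have := leq_mul hU2 hV2; move: hI.
move: (\sum_(l <- L) _)%N => I hI.
move/(leq_mul (leqnn (#|` U| * #|` V|)%N)); move/(leq_mul (leqnn (r ^ 2)%N)): hI; lia.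
Qed.

End Incidences.

(** Lines of average richness at least [k]: for [r] close to [k / 4] the linear term
    [2 * r * size L] is at most [J / 2] and is absorbed. Taking [J = k * size L] gives the usual
    bound for [k]-rich lines; a free [J] allows richness on average only. *)
Lemma szemeredi_trotter (R : realType) (U V : {fset R}) (L : seq (R * R)) (k J : R) :
  uniq L -> {in L, forall l, 0 < l.1} -> 4 <= k -> k <= #|` U|%:R -> k <= #|` V|%:R ->
  k * (size L)%:R <= J -> J <= (\sum_(l <- L) inc U V l)%:R ->
  k ^+ 2 * J <= 512 * #|` U|%:R ^+ 2 * #|` V|%:R ^+ 2.
Proof.
move=> uL L0 k4 kU kV kJ JI.
pose r := Num.truncn (k / 4).
have k40 : 0 <= k / 4 by lra.
have r1 : r%:R <= k / 4 by rewrite /r truncn_le.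
have r2 : k / 4 < r%:R + 1 by rewrite natr1 /r truncnS_gt.
have r0 : (0 < r)%N by rewrite truncn_gt0; lra.
have r0' : (1 : R) <= r%:R by rewrite ler1n.
have rU : (r <= #|` U|)%N by rewrite -(ler_nat R); lra.
have rV : (r <= #|` V|)%N by rewrite -(ler_nat R); lra.
have := incidence_bound uL L0 r0 rU rV.
rewrite -(ler_nat R) natrD !(natrX, natrM).
set u : R := #|` U|%:R; set v : R := #|` V|%:R; set s : R := (size L)%:R.
set x : R := r%:R => h.
set I : R := (\sum_(l <- L) _)%:R in h JI.
have s0 : 0 <= s by rewrite ler0n.
rewrite -/x in r1 r2 r0'.
(* From [k < 4 * (x + 1)] and [1 <= x]. Hence [k ^+ 2 <= 64 * x ^+ 2], and 512 is 64 * 8. *)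
have k8 : k <= 8 * x by lra.
have h1 : 2 * x * s <= J / 2.
  apply: le_trans (_ : (k / 2) * s <= _); first by rewrite ler_wpM2r //; lra.
  lra.
have h2 : x ^+ 2 * (J / 2) <= 4 * u ^+ 2 * v ^+ 2.
  have : x ^+ 2 * (2 * x * s) <= x ^+ 2 * (J / 2) by rewrite ler_wpM2l ?sqr_ge0.
  have : x ^+ 2 * J <= x ^+ 2 * I by rewrite ler_wpM2l ?sqr_ge0.
  lra.
have J0 : 0 <= J by apply: le_trans kJ; rewrite mulr_ge0 //; lra.
have k2 : k ^+ 2 <= 64 * x ^+ 2 by nra.
have : k ^+ 2 * J <= 64 * x ^+ 2 * J by rewrite ler_wpM2r.
lra.
Qed.

(** * Third moments *)

Definition harmonic (R : realType) (N : nat) : R := \sum_(1 <= k < N.+1) k%:R^-1.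

Lemma harmonic_ge0 (R : realType) N : 0 <= harmonic R N.
Proof. by apply: sumr_ge0 => k _; rewrite invr_ge0. Qed.

(** Write [f x ^ p.+1] as at most the sum of [p.+1 * k ^ p] over [1 <= k <= f x] and exchange sums:
    the level set of [k] then contributes at most [p.+1 * C / k]. *)
Lemma layer_cake (R : realType) (T : eqType) (s : seq T) (f : T -> nat) (p N : nat) (C : R) :
  {in s, forall x, f x <= N}%N ->
  (forall k, (0 < k)%N -> k%:R ^+ p.+1 * (\sum_(x <- s) (k <= f x))%N%:R <= C) ->
  \sum_(x <- s) (f x)%:R ^+ p.+1 <= p.+1%:R * C * harmonic R N.
Proof.
move=> fN hC.
have step n : ((n.+1 ^ p.+1) <= n ^ p.+1 + p.+1 * n.+1 ^ p)%N.
  elim: (p) => [|q IH]; first by rewrite !expn1 expn0; lia.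
  have : (n ^ q <= n.+1 ^ q)%N by case: (q) => [|e]; rewrite ?expn0 ?leq_exp2r.
  move: IH; rewrite !(expnS _ q.+1) !(expnS _ q); nia.
have pw n : (n ^ p.+1 <= \sum_(1 <= k < n.+1) p.+1 * k ^ p)%N.
  elim: n => [|n IH]; first by rewrite exp0n.
  by rewrite big_nat_recr //= (leq_trans (step n)) // leq_add2r.
have cut x : x \in s ->
    (f x)%:R ^+ p.+1 <= \sum_(1 <= k < N.+1) p.+1%:R * k%:R ^+ p * (k <= f x)%N%:R :> R.
  move=> /fN fxN; rewrite -natrX.
  apply: le_trans (_ : (\sum_(1 <= k < (f x).+1) p.+1 * k ^ p)%N%:R <= _); first by rewrite ler_nat.
  rewrite natr_sum [leRHS](@big_cat_nat _ _ _ (f x).+1) //=.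
  rewrite -[leLHS]addr0 lerD //; last by apply: sumr_ge0 => k _; rewrite !mulr_ge0 ?exprn_ge0.
  rewrite [leRHS]big_nat [leLHS]big_nat; apply: ler_sum => k /andP[_ kf].
  by rewrite -ltnS kf mulr1 natrM natrX.
apply: le_trans (_ : \sum_(x <- s) \sum_(1 <= k < N.+1) p.+1%:R * k%:R ^+ p * (k <= f x)%N%:R <= _).
  by rewrite big_seq [leRHS]big_seq; apply: ler_sum => x; apply: cut.
rewrite exchange_big /= /harmonic big_distrr /= big_nat [leRHS]big_nat.
apply: ler_sum => k /andP[k0 _]; rewrite -big_distrr /= -natr_sum.
have k0' : (0 : R) < k%:R by rewrite ltr0n.
rewrite ler_pdivlMr //; have := hC k k0; set S : R := (\sum_(x <- s) _)%N%:R => hS.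
have -> : p.+1%:R * k%:R ^+ p * S * k%:R = p.+1%:R * (k%:R ^+ p.+1 * S).
  by rewrite exprS; ring.
by rewrite ler_wpM2l.
Qed.

Section Moments.
Variable R : realType.
Implicit Types (A B U V Y Z Lam : {fset R}).

(** The number of representations of [z] as [a - b] with [a] in [A] and [b] in [B]. *)
Definition rep A B (z : R) : nat := (\sum_(a <- A) (a - z \in B)%R)%N.

Lemma rep_le_l A B z : (rep A B z <= #|` A|)%N.
Proof. by rewrite card_fset_sum1; apply: leq_sum => a _; case: (_ \in _). Qed.

Lemma rep_le_r A B z : (rep A B z <= #|` B|)%N.
Proof. by apply: sum_mem_le => x y _ _ /addIr. Qed.

Lemma sum_rep_le A B Z : (\sum_(z <- Z) rep A B z <= #|` A| * #|` B|)%N.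
Proof.
rewrite exchange_big card_fset_sum1 big_distrl /=; apply: leq_sum => a _.
by rewrite mul1n; apply: sum_mem_le => x y _ _ /addrI /oppr_inj.
Qed.

(** The lines are parallel, so each point of the product lies on at most one of them. *)
Lemma sum_inc_le U V (l : R) Z : l != 0 ->
  (\sum_(z <- Z) inc U V (l, z) <= #|` U| * #|` V|)%N.
Proof.
move=> l0; rewrite exchange_big card_fset_sum1 big_distrl /=; apply: leq_sum => a _.
by rewrite mul1n; apply: sum_mem_le => x y _ _ /addrI.
Qed.

(* The line [y = l u - z] carries an incidence for each [a = l u] counted by [rep]. *)
Lemma rep_le_inc A B U (l z : R) : l != 0 ->
  (\sum_(a <- A) (a - z \in B)%R * (a / l \in U)%R <= inc U B (l, - z)%R)%N.
Proof.
move=> l0; under eq_bigr => a _ do rewrite -(sum_eq_mem U) big_distrr /=.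
rewrite exchange_big /=; apply: leq_sum => u _.
apply: (@leq_trans (\sum_(a <- A) (l * u - z \in B)%R * (a == l * u)%R)%N).
  apply: leq_sum => a _; case: eqP => [->|]; last by rewrite muln0.
  by rewrite mulrCA mulfV // mulr1 eqxx.
rewrite -big_distrr /line /= sum_eq_mem.
by case: (_ \in A); rewrite ?muln1 ?muln0.
Qed.

(** Every [a] in [A] equals [l * u] in at least [q] ways. Each [z] of the level set therefore
    yields, through the lines of slope [l] and intercept [- z], at least [k * q] incidences with the
    product of [U] and [B], and Szemeredi-Trotter applies. *)
Lemma rep_level A B U Lam Z (q : R) (k : nat) :
  {in Lam, forall l, 0 < l} -> 0 < q -> q <= #|` U|%:R ->
  {in A, forall a, q <= (\sum_(l <- Lam) (a / l \in U)%R)%N%:R} ->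
  (#|` A| <= #|` U|)%N -> (0 < k)%N ->
  k%:R ^+ 3 * (\sum_(z <- Z) (k <= rep A B z))%N%:R <=
    512 * #|` U|%:R ^+ 2 * #|` B|%:R ^+ 2 * #|` Lam|%:R ^+ 2 / q ^+ 3.
Proof.
move=> Lam0 q0 qU qA AU k0.
set Zk := [fset z in Z | (k <= rep A B z)%N].
rewrite -card_filter -/Zk.
have [->|[z0 z0Z]] := fset_0Vmem Zk.
  by rewrite cardfs0 mulr0 !mulr_ge0 ?invr_ge0 ?exprn_ge0 // ltW.
have k_rep : (k <= rep A B z0)%N by move: z0Z; rewrite !inE => /andP[].
have kA := leq_trans k_rep (rep_le_l A B z0).
have kB := leq_trans k_rep (rep_le_r A B z0).
have [a0 a0A] : exists a, a \in A.
  by have [A0|[a aA]] := fset_0Vmem A; [move: kA; rewrite A0 cardfs0 leqNgt k0 | exists a].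
have qLam : q <= #|` Lam|%:R.
  apply: le_trans (qA _ a0A) _; rewrite ler_nat card_fset_sum1.
  by apply: leq_sum => l _; case: (_ \in _).
set L : R := #|` Lam|%:R in qLam *.
have L0 : 0 < L by apply: lt_le_trans qLam.
(* [J] bounds the incidences from below, and [kap] is [J] divided by the number of lines. *)
set J : R := #|` Zk|%:R * k%:R * q.
pose kap : R := k%:R * q / L.
pose Ls := [seq (l, - z) | l <- Lam, z <- Zk].
have Lsu : uniq Ls.
  by apply: allpairs_uniq (fset_uniq _) (fset_uniq _) _ => -[a b] [c d] _ _ [-> /oppr_inj ->].
have Ls0 : {in Ls, forall l, 0 < l.1}.
  by move=> l /allpairsP[[a b] /= [aL _ ->]]; apply: Lam0.
have kJ : kap * (size Ls)%:R <= J.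
  rewrite size_allpairs natrM -/L /kap /J.
  by rewrite mulrA mulfVK ?gt_eqF // mulrC mulrA.
have JI : J <= (\sum_(l <- Ls) inc U B l)%N%:R.
  rewrite big_allpairs_dep /= exchange_big /=.
  apply: le_trans (_ : (\sum_(z <- Zk) \sum_(l <- Lam) \sum_(a <- A)
     (a - z \in B)%R * (a / l \in U)%R)%N%:R <= _); last first.
    rewrite ler_nat; apply: leq_sum => z _; rewrite big_seq [leqRHS]big_seq.
    by apply: leq_sum => l lL; apply: rep_le_inc; rewrite gt_eqF ?Lam0.
  rewrite /J card_fset_sum1 !natr_sum !big_distrl /= big_seq [leRHS]big_seq.
  apply: ler_sum => z; rewrite !inE => /andP[_ kz].
  rewrite mul1r exchange_big /= natr_sum.
  apply: le_trans (_ : (rep A B z)%:R * q <= _); first by rewrite ler_wpM2r ?ler_nat // ltW.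
  rewrite /rep natr_sum big_distrl /= big_seq [leRHS]big_seq; apply: ler_sum => a aA.
  rewrite -big_distrr natrM ler_wpM2l //=; exact: qA.
have kapk : kap <= k%:R by rewrite /kap ler_pdivrMr // ler_wpM2l.
have kU : (k%:R : R) <= #|` U|%:R by rewrite ler_nat (leq_trans kA).
have kB' : (k%:R : R) <= #|` B|%:R by rewrite ler_nat.
have main : kap ^+ 2 * J <= 512 * #|` U|%:R ^+ 2 * #|` B|%:R ^+ 2.
  have [k4|k4] := leP 4 kap.
    by apply: (szemeredi_trotter Lsu Ls0 k4 _ _ kJ JI); apply: le_trans kapk _.
  have kap0 : 0 <= kap by rewrite /kap !mulr_ge0 ?invr_ge0 // ltW.
  have J0 : 0 <= J by rewrite /J !mulr_ge0 // ltW.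
  (* For [kap < 4] the trivial bound suffices: the values of [rep A B] sum to at most [#|A| * #|B|],
     and [q] is at most [#|U|]. *)
  have J1 : J <= #|` U|%:R * #|` B|%:R * #|` U|%:R.
    rewrite /J; apply: ler_pM; rewrite ?mulr_ge0 ?(ltW q0) // -!natrM ler_nat.
    apply: leq_trans (leq_trans (sum_rep_le A B Zk) _); last by rewrite leq_mul2r AU orbT.
    rewrite card_fset_sum1 big_distrl /= big_seq [leqRHS]big_seq.
    by apply: leq_sum => z; rewrite !inE mul1n => /andP[].
  have B1 : 1 <= #|` B|%:R :> R by rewrite ler1n (leq_trans k0 kB).
  apply: le_trans (_ : 16 * J <= _); first by rewrite ler_wpM2r //; nra.
  apply: le_trans (_ : 16 * (#|` U|%:R ^+ 2 * #|` B|%:R) <= _); first by lra.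
  rewrite -[leRHS]mulrA ler_pM ?ler_wpM2l ?exprn_ge0 ?mulr_ge0 //; first by lra.
  by rewrite expr2 ler_peMr.
rewrite ler_pdivlMr ?exprn_gt0 //.
have -> : k%:R ^+ 3 * #|` Zk|%:R * q ^+ 3 = (kap ^+ 2 * J) * L ^+ 2.
  by rewrite /kap /J; field; rewrite gt_eqF.
by rewrite ler_wpM2r ?exprn_ge0 // ltW.
Qed.

(** [layer_cake] with exponent 3 turns [rep_level] into a moment bound; 1536 is 3 * 512. *)
Lemma rep_third_moment A B U Lam Z (q : R) (N : nat) :
  {in Lam, forall l, 0 < l} -> 0 < q -> q <= #|` U|%:R ->
  {in A, forall a, q <= (\sum_(l <- Lam) (a / l \in U)%R)%N%:R} ->
  (#|` A| <= #|` U|)%N -> (#|` A| <= N)%N ->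
  \sum_(z <- Z) (rep A B z)%:R ^+ 3 <=
    1536 * (#|` U|%:R ^+ 2 * #|` B|%:R ^+ 2 * #|` Lam|%:R ^+ 2 / q ^+ 3) * harmonic R N.
Proof.
move=> Lam0 q0 qU qA AU AN.
have := @layer_cake R _ Z (rep A B) 2 N _ (fun z _ => leq_trans (rep_le_l A B z) AN)
  (fun k k0 => rep_level B Z Lam0 q0 qU qA AU k0).
move=> /le_trans; apply; rewrite le_eqVlt; apply/orP; left; apply/eqP; ring.
Qed.

(** The count of collinear triples in the square of [A], by [layer_cake] from the bound
    [k ^ 3 * size L <= 512 * n ^ 4] for [k]-rich lines. *)
Lemma inc_third_moment A Lam Y (N : nat) : {in Lam, forall l, 0 < l} ->
  (#|` Lam| <= #|` A| ^ 2)%N -> (#|` A| <= N)%N ->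
  \sum_(l <- Lam) \sum_(y <- Y) (inc A A (l, y))%:R ^+ 3 <=
    1536 * #|` A|%:R ^+ 4 * harmonic R N.
Proof.
move=> Lam0 LamA AN; set n : R := #|` A|%:R.
pose s := [seq (l, y) | l <- Lam, y <- Y].
have su : uniq s.
  by apply: allpairs_uniq (fset_uniq _) (fset_uniq _) _ => -[a b] [c d] _ _.
have incA l : (inc A A l <= #|` A|)%N.
  by rewrite card_fset_sum1; apply: leq_sum => a _; case: (_ \in _).
have <- : \sum_(l <- s) (inc A A l)%:R ^+ 3 =
    \sum_(l <- Lam) \sum_(y <- Y) (inc A A (l, y))%:R ^+ 3 :> R.
  by rewrite big_allpairs_dep.
suff lev k : (0 < k)%N -> k%:R ^+ 3 * (\sum_(l <- s) (k <= inc A A l))%N%:R <= 512 * n ^+ 4.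
  have := @layer_cake R _ s (inc A A) 2 N _ (fun z _ => leq_trans (incA z) AN) lev.
  by move=> /le_trans; apply; rewrite le_eqVlt; apply/orP; left; apply/eqP; ring.
move=> k0; pose L := filter (fun l => k <= inc A A l)%N s.
rewrite -count_sum -size_filter -/L.
case: (ltnP #|` A| k) => kA.
  have -> : L = [::].
    apply/eqP; rewrite -size_eq0 size_filter -leqn0 leqNgt -has_count.
    by apply/hasPn => l _; rewrite -ltnNge (leq_ltn_trans (incA l)).
  by rewrite mulr0 mulr_ge0 ?exprn_ge0.
have kL : k%:R * (size L)%:R <= (\sum_(l <- L) inc A A l)%N%:R :> R.
  rewrite -natrM ler_nat -sum1_size big_distrr /= big_seq [leqRHS]big_seq.
  by apply: leq_sum => l; rewrite mem_filter muln1 => /andP[].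
have kA' : k%:R <= n by rewrite ler_nat.
have Lu : uniq L by rewrite filter_uniq.
have L0 : {in L, forall l, 0 < l.1}.
  by move=> l; rewrite mem_filter => /andP[_ /allpairsP[[a b] /= [aL _ ->]]]; apply: Lam0.
have -> : k%:R ^+ 3 * (size L)%:R = k%:R ^+ 2 * (k%:R * (size L)%:R) :> R by ring.
have [k4|k4] := leP (4 : R) k%:R.
  have := szemeredi_trotter Lu L0 k4 kA' kA' (lexx _) kL.
  by move=> /le_trans; apply; rewrite -/n le_eqVlt; apply/orP; left; apply/eqP; ring.
(* For [k < 4], each slope carries at most [n ^ 2] incidences and there are at most [n ^ 2]
   slopes. *)
apply: le_trans (_ : 16 * n ^+ 4 <= _); last by rewrite ler_wpM2r ?exprn_ge0 //; lra.
apply: ler_pM; rewrite ?exprn_ge0 ?mulr_ge0 //.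
  by rewrite -natrX ler_nat; move: k4; rewrite ltr_nat; nia.
apply: le_trans kL _; rewrite /n -natrX ler_nat.
apply: leq_trans (_ : \sum_(l <- s) inc A A l <= _)%N.
  by rewrite big_filter big_mkcond; apply: leq_sum => l _; case: ifP.
rewrite big_allpairs_dep; apply: leq_trans (_ : \sum_(l <- Lam) #|` A| * #|` A| <= _)%N.
  rewrite big_seq [leqRHS]big_seq; apply: leq_sum => l lL.
  by apply: sum_inc_le; rewrite gt_eqF ?Lam0.
rewrite big_const_seq count_predT iter_addn_0 mulnn.
by rewrite (expnD _ 2 2) leq_mul2l LamA orbT.
Qed.

End Moments.

(** * Cauchy-Schwarz, Hoelder and collision counting *)

Section Tools.
Variable R : realType.

(** The hypothesis [h i ^+ 2 <= a i * b i] avoids square roots. Expanding both sides over pairs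
    leaves [2 * (h i * h j) <= a i * b j + a j * b i], checked by squaring. *)
Lemma cauchy_schwarz_sum (T : Type) (s : seq T) (h a b : T -> R) :
  (forall i, 0 <= h i) -> (forall i, 0 <= a i) -> (forall i, 0 <= b i) ->
  (forall i, h i ^+ 2 <= a i * b i) ->
  (\sum_(i <- s) h i) ^+ 2 <= (\sum_(i <- s) a i) * (\sum_(i <- s) b i).
Proof.
move=> h0 a0 b0 hab.
have pt i j : 2 * (h i * h j) <= a i * b j + a j * b i.
  rewrite -ler_sqr ?nnegrE ?addr_ge0 ?mulr_ge0 //.
  have := ler_pM (sqr_ge0 (h i)) (sqr_ge0 (h j)) (hab i) (hab j).
  have := sqr_ge0 (a i * b j - a j * b i); nra.
rewrite -(ler_pM2l (_ : 0 < 2 :> R)) //.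
have -> : 2 * (\sum_(i <- s) h i) ^+ 2 = \sum_(i <- s) \sum_(j <- s) 2 * (h i * h j).
  rewrite expr2 big_distrl /= big_distrr /=; apply: eq_bigr => i _.
  by rewrite big_distrr /= big_distrr.
have -> : 2 * ((\sum_(i <- s) a i) * (\sum_(i <- s) b i)) =
    \sum_(i <- s) \sum_(j <- s) (a i * b j + a j * b i).
  under [RHS]eq_bigr => i _ do rewrite big_split /= -big_distrr -big_distrl /=.
  by rewrite big_split /= -big_distrl -big_distrr /=; ring.
by apply: ler_sum => i _; apply: ler_sum => j _.
Qed.

(* AM-GM applied to the three terms of each triple product. *)
Lemma holder_sum (T : Type) (s : seq T) (f g : T -> R) :
  (forall i, 0 <= f i) -> (forall i, 0 <= g i) ->
  (\sum_(i <- s) f i ^+ 2 * g i) ^+ 3 <=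
  (\sum_(i <- s) f i ^+ 3) ^+ 2 * (\sum_(i <- s) g i ^+ 3).
Proof.
move=> f0 g0; pose F i := f i ^+ 3; pose G i := g i ^+ 3.
have amgm (u v w : R) : 0 <= u -> 0 <= v -> 0 <= w -> 3 * (u * v * w) <= u ^+ 3 + v ^+ 3 + w ^+ 3.
  move=> u0 v0 w0; rewrite -subr_ge0.
  have -> : u ^+ 3 + v ^+ 3 + w ^+ 3 - 3 * (u * v * w) =
    (u + v + w) * ((u - v) ^+ 2 + (v - w) ^+ 2 + (u - w) ^+ 2) / 2 by field.
  by rewrite !mulr_ge0 ?addr_ge0 ?sqr_ge0 ?invr_ge0.
have pt i j k : 3 * ((f i ^+ 2 * g i) * ((f j ^+ 2 * g j) * (f k ^+ 2 * g k))) <=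
    F i * (F j * G k) + F i * (G j * F k) + G i * (F j * F k).
  have -> : (f i ^+ 2 * g i) * ((f j ^+ 2 * g j) * (f k ^+ 2 * g k)) =
    (f i * (f j * g k)) * (f i * (g j * f k)) * (g i * (f j * f k)) by ring.
  have -> : F i * (F j * G k) + F i * (G j * F k) + G i * (F j * F k) =
    (f i * (f j * g k)) ^+ 3 + (f i * (g j * f k)) ^+ 3 + (g i * (f j * f k)) ^+ 3.
    by rewrite /F /G; ring.
  by apply: amgm; rewrite !mulr_ge0.
have triple (a b c : T -> R) : (\sum_(i <- s) a i) * ((\sum_(i <- s) b i) * (\sum_(i <- s) c i)) =
    \sum_(i <- s) \sum_(j <- s) \sum_(k <- s) a i * (b j * c k).
  rewrite big_distrl; apply: eq_bigr => i _ /=; rewrite big_distrl big_distrr.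
  by apply: eq_bigr => j _ /=; rewrite big_distrr big_distrr.
rewrite -(ler_pM2l (_ : 0 < 3 :> R)) //.
have -> : (\sum_(i <- s) F i) ^+ 2 * (\sum_(i <- s) G i) =
  (\sum_(i <- s) F i) * ((\sum_(i <- s) F i) * (\sum_(i <- s) G i)) by ring.
have -> : 3 * ((\sum_(i <- s) F i) * ((\sum_(i <- s) F i) * (\sum_(i <- s) G i))) =
  (\sum_(i <- s) F i) * ((\sum_(i <- s) F i) * (\sum_(i <- s) G i)) +
  (\sum_(i <- s) F i) * ((\sum_(i <- s) G i) * (\sum_(i <- s) F i)) +
  (\sum_(i <- s) G i) * ((\sum_(i <- s) F i) * (\sum_(i <- s) F i)) by ring.
rewrite !exprS expr0 mulr1 !triple -!big_split big_distrr /=; apply: ler_sum => i _.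
rewrite -!big_split big_distrr /=; apply: ler_sum => j _.
rewrite -!big_split big_distrr /=; apply: ler_sum => k _; exact: pt.
Qed.

(** Cauchy-Schwarz over the fibres of [phi]. *)
Lemma collision_bound (T : eqType) (T' : choiceType) (s : seq T) (phi : T -> T') (Y : {fset T'}) :
  {in s, forall i, phi i \in Y} ->
  (size s)%:R ^+ 2 <= #|` Y|%:R * (\sum_(i <- s) \sum_(j <- s) (phi i == phi j))%N%:R :> R.
Proof.
move=> sY; pose c y : R := (\sum_(i <- s) (y == phi i))%N%:R.
have -> : (size s)%:R = \sum_(y <- Y) c y.
  rewrite /c -natr_sum exchange_big -sum1_size /= big_seq [in RHS]big_seq.
  by congr _%:R; apply: eq_bigr => i /sY iY; rewrite sum_eq_mem iY.
have -> : (\sum_(i <- s) \sum_(j <- s) (phi i == phi j))%N%:R = \sum_(y <- Y) c y ^+ 2.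
  under [RHS]eq_bigr => y _ do rewrite /c -natrX -mulnn big_distrl /=.
  rewrite -natr_sum; congr _%:R; rewrite [RHS]exchange_big /= big_seq [RHS]big_seq.
  apply: eq_bigr => i /sY iY; under [RHS]eq_bigr => y _ do rewrite big_distrr /=.
  rewrite [RHS]exchange_big /=; apply: eq_bigr => j _.
  rewrite (big_fsetD1 _ iY) /= eqxx mul1n big_seq big1 ?addn0 // => y.
  by rewrite !inE => /andP[/negPf -> _].
have -> : #|` Y|%:R = \sum_(y <- Y) (1 : R) by rewrite card_fset_sum1 natr_sum.
by apply: cauchy_schwarz_sum => y //; rewrite ?sqr_ge0 ?mul1r.
Qed.

End Tools.

(** * Energies *)

Section Energies.
Variable R : realType.
Implicit Types (A B S W Z : {fset R}).

Lemma sum_prod4 (T : Type) (s1 s1' s2 s2' : seq T) (u v : T -> T -> nat) :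
  ((\sum_(x <- s1) \sum_(x' <- s1') u x x') * (\sum_(y <- s2) \sum_(y' <- s2') v y y') =
   \sum_(x <- s1) \sum_(y <- s2) \sum_(x' <- s1') \sum_(y' <- s2') u x x' * v y y')%N.
Proof.
rewrite big_distrl /=; apply: eq_bigr => x _; rewrite big_distrr /=; apply: eq_bigr => y _.
by rewrite big_distrl /=; apply: eq_bigr => x' _; rewrite big_distrr.
Qed.

Lemma repE A B z : rep A B z = (\sum_(a <- A) \sum_(b <- B) (b == a - z)%R)%N.
Proof. by apply: eq_bigr => a _; rewrite sum_eq_mem. Qed.

Lemma incE A B l : inc A B l = (\sum_(a <- A) \sum_(b <- B) (b == line l a)%R)%N.
Proof. by apply: eq_bigr => a _; rewrite sum_eq_mem. Qed.

Definition differences A : {fset R} := [fset a - b | a in A, b in A].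
Definition ratios A : {fset R} := [fset a / b | a in A, b in A].
(** For [A] positive, the number of representations of [l] as a ratio of two elements of [A]; its
    second moment is the multiplicative energy. *)
Definition quot A (l : R) : nat := (\sum_(a <- A) (a / l \in A)%R)%N.

(** Solutions of [a + b = c + d] are sorted by the common difference [w = a - c = d - b]. *)
Lemma add_energy_le A B Z : {in B &, forall a c, a - c \in Z} ->
  (\sum_(a <- B) \sum_(b <- A) \sum_(c <- B) \sum_(d <- A) (a + b == c + d)%R
   <= \sum_(w <- Z) rep B B w * rep A A w)%N.
Proof.
move=> BZ; apply: leq_trans (_ : \sum_(w <- Z) (\sum_(a <- B) \sum_(c <- B) (c == a - w)%R) *
   (\sum_(b <- A) \sum_(d <- A) (b == d - w)%R) <= _)%N; last first.
  apply: leq_sum => w _; rewrite -repE leq_mul2l; apply/orP; right.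
  by rewrite exchange_big /= -repE.
under [leqRHS]eq_bigr => w _ do rewrite sum_prod4.
rewrite [leqRHS]exchange_big /= big_seq [leqRHS]big_seq; apply: leq_sum => a aB.
rewrite [leqRHS]exchange_big /=; apply: leq_sum => b _.
rewrite [leqRHS]exchange_big /= big_seq [leqRHS]big_seq; apply: leq_sum => c cB.
rewrite [leqRHS]exchange_big /=; apply: leq_sum => d _.
rewrite (big_fsetD1 _ (BZ _ _ aB cB)) /=; case: eqP => // e.
have -> : c == a - (a - c) by apply/eqP; ring.
have -> // : b == d - (a - c).
by apply/eqP; move: e; lra.
Qed.

(** Solutions are sorted by [y = c' - l * c = l * b - b']: one point of the square of [A] lies on
    the line of intercept [y], another on the parallel line of intercept [- y]. *)
Lemma dilate_energy_le A W (l : R) : {in A &, forall c d, d - l * c \in W} ->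
  (\sum_(b <- A) \sum_(c <- A) \sum_(b' <- A) \sum_(c' <- A) (l * (b + c) == b' + c')%R
   <= \sum_(y <- W) inc A A (l, - y)%R * inc A A (l, y))%N.
Proof.
move=> hW; under [leqRHS]eq_bigr => y _ do rewrite !incE sum_prod4.
rewrite [leqRHS]exchange_big /=; apply: leq_sum => b _.
rewrite [leqRHS]exchange_big /= big_seq [leqRHS]big_seq; apply: leq_sum => c cA.
rewrite [leqRHS]exchange_big /=; apply: leq_sum => b' _.
rewrite [leqRHS]exchange_big /= big_seq [leqRHS]big_seq; apply: leq_sum => c' c'A.
rewrite (big_fsetD1 _ (hW _ _ cA c'A)) /=; case: eqP => // e; rewrite /line /=.
have -> : c' == l * c + (c' - l * c) by apply/eqP; ring.
have -> // : b' == l * b - (c' - l * c).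
by apply/eqP; move: e; lra.
Qed.

Lemma sum_ratios A (G : R -> nat) : {in A, forall a, 0 < a} ->
  (\sum_(a <- A) \sum_(b <- A) G (a / b)%R <= \sum_(l <- ratios A) quot A l * G l)%N.
Proof.
move=> A0; apply: leq_trans (_ : \sum_(l <- ratios A) \sum_(a <- A) \sum_(b <- A)
   (b == a / l)%R * G l <= _)%N; last first.
  apply: leq_sum => l _; rewrite /quot big_distrl /=; apply: leq_sum => a _.
  by rewrite -big_distrl /= sum_eq_mem.
rewrite [leqRHS]exchange_big /= big_seq [leqRHS]big_seq; apply: leq_sum => a aA.
rewrite [leqRHS]exchange_big /= big_seq [leqRHS]big_seq; apply: leq_sum => b bA.
have ab : a / b \in ratios A by apply/imfset2P; exists a => //; exists b.
have a0 := A0 _ aA; have b0 := A0 _ bA.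
rewrite (big_fsetD1 _ ab) /=; have -> : b == a / (a / b).
  by apply/eqP; field; rewrite !gt_eqF.
by rewrite mul1n leq_addr.
Qed.

Lemma sum_quot_le A : {in A, forall a, 0 < a} ->
  (\sum_(l <- ratios A) quot A l <= #|` A| ^ 2)%N.
Proof.
move=> A0; rewrite exchange_big card_fset_sum1 -mulnn [leqRHS]big_distrl /=.
rewrite big_seq [leqRHS]big_seq; apply: leq_sum => a aA.
rewrite mul1n -card_fset_sum1; apply: sum_mem_le => x y _ _ /mulfI.
by move=> /(_ (negbT (gt_eqF (A0 _ aA)))) /invr_inj.
Qed.

Lemma ratios_gt0 A : {in A, forall a, 0 < a} -> {in ratios A, forall l, 0 < l}.
Proof. by move=> A0 l /imfset2P[a /= aA [b /= bA ->]]; rewrite divr_gt0 ?A0. Qed.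

Lemma card_ratios A : (#|` ratios A| <= #|` A| ^ 2)%N.
Proof.
rewrite -mulnn -(size_allpairs (fun a b : R => a / b)).
apply: uniq_leq_size => // l /imfset2P[a /= aA [b /= bA ->]].
by apply/allpairsP; exists (a, b).
Qed.

Definition meet_shift A z : {fset R} := [fset a in A | a - z \in A].

(* Uses the Katz-Koester inclusion: [meet_shift A z + A] lies in
   [S :&: (S + z)] whenever [A + A] does in [S]. *)
Lemma katz_koester A S z : {in A &, forall a b, a + b \in S} ->
  (rep A A z)%:R ^+ 2 * #|` A|%:R ^+ 2 <=
  (rep S S z)%:R *
  (\sum_(a <- meet_shift A z) \sum_(b <- A) \sum_(c <- meet_shift A z) \sum_(d <- A)
      (a + b == c + d)%R)%N%:R :> R.
Proof.
move=> AS; set B := meet_shift A z; pose s := [seq (a, b) | a <- B, b <- A].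
have szB : rep A A z = #|` B| by rewrite /B card_filter.
have := @collision_bound R _ _ s (fun p => p.1 + p.2) [fset x in S | x - z \in S].
rewrite size_allpairs natrM exprMn -szB card_filter -/(rep S S z).
rewrite big_allpairs_dep /=; move=> h; apply: le_trans (h _) _.
  move=> i /allpairsP[[a b] /= [aB bA ->]] /=; move: aB; rewrite !inE /= => /andP[aA azA].
  by rewrite AS //= addrAC AS.
rewrite ler_wpM2l // ler_nat; apply: leq_sum => a _; apply: leq_sum => b _.
by rewrite big_allpairs_dep.
Qed.

(** With [b = a - z], the left side counts pairs [a], [b] for which [a], [b], [a - w] and [b - w]
    all lie in [A]; [a] and [b] each have [rep A A w] choices. *)
Lemma sum_local_rep_le A Z w :
  (\sum_(z <- Z) rep (meet_shift A z) (meet_shift A z) w <= rep A A w ^ 2)%N.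
Proof.
rewrite -mulnn [X in (_ <= X * _)%N]/rep big_distrl /=.
apply: leq_trans (_ : \sum_(z <- Z) \sum_(a <- A)
  (a - w \in A)%R * ((a - z \in A)%R * (a - z - w \in A)%R) <= _)%N.
  apply: leq_sum => z _; rewrite /rep {1}/meet_shift big_fset /= big_mkcond /=.
  apply: leq_sum => a _; case: ifP => // az; rewrite !inE mul1n.
  by case: (a - w \in A); rewrite //= mul1n addrAC.
rewrite exchange_big /=; apply: leq_sum => a _; rewrite -big_distrr leq_mul2l /=.
apply/orP; right.
apply: leq_trans (_ : \sum_(z <- Z) \sum_(b <- A) (b == a - z)%R * (b - w \in A)%R <= _)%N.
  apply: leq_sum => z _; case az: (a - z \in A); last by rewrite mul0n.
  by rewrite (big_fsetD1 _ az) /= eqxx leq_addr.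
rewrite exchange_big /=; apply: leq_sum => b _; rewrite -big_distrl /=.
rewrite -[leqRHS]mul1n leq_mul2r; apply/orP; right.
by apply: (sum_le1 (fset_uniq Z)) => x y _ _ /eqP-> /eqP/addrI/oppr_inj.
Qed.

(* The energies in [katz_koester] add up over [z] to at most the third moment of
   [rep A A]. *)
Lemma energy_third_moments A S Z : {in A &, forall a b, a + b \in S} ->
  {in A &, forall a c, a - c \in Z} ->
  ((\sum_(z <- Z) (rep A A z)%:R ^+ 2) * #|` A|%:R) ^+ 6 <=
  (\sum_(z <- Z) (rep A A z)%:R ^+ 3) ^+ 5 * (\sum_(z <- Z) (rep S S z)%:R ^+ 3) :> R.
Proof.
move=> AS AZ; set m : R := #|` A|%:R.
set Phi : R := \sum_(z <- Z) _ ^+ 2; set E3 : R := \sum_(z <- Z) (rep A A z)%:R ^+ 3.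
set G3 : R := \sum_(z <- Z) _.
pose f z : R := (rep A A z)%:R; pose g z : R := (rep S S z)%:R.
pose B := meet_shift A.
pose e z := (\sum_(a <- B z) \sum_(b <- A) \sum_(c <- B z) \sum_(d <- A) (a + b == c + d)%R)%N.
have eE3 : (\sum_(z <- Z) e z)%N%:R <= E3.
  have -> : E3 = (\sum_(z <- Z) rep A A z ^ 3)%N%:R.
    by rewrite natr_sum; apply: eq_bigr => z _; rewrite natrX.
  rewrite ler_nat; apply: leq_trans (_ : \sum_(z <- Z) \sum_(w <- Z) rep (B z) (B z) w * rep A A w <= _)%N.
    apply: leq_sum => z _; apply: add_energy_le => a c.
    by rewrite !inE => /andP[aA _] /andP[cA _]; apply: AZ.
  rewrite exchange_big /=; apply: leq_sum => w _; rewrite -big_distrl expnSr leq_mul2r /=.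
  by rewrite sum_local_rep_le orbT.
(* Termwise, [katz_koester] gives [(f z ^+ 2 * m) ^+ 2 <= (f z ^+ 2 * g z) * e z]. *)
have cs : (Phi * m) ^+ 2 <= (\sum_(z <- Z) f z ^+ 2 * g z) * E3.
  apply: le_trans (_ : (\sum_(z <- Z) f z ^+ 2 * g z) * (\sum_(z <- Z) e z)%N%:R <= _); last first.
    by rewrite ler_wpM2l // sumr_ge0 // => z _; rewrite mulr_ge0 ?exprn_ge0.
  rewrite natr_sum /Phi big_distrl /=; apply: cauchy_schwarz_sum => z //.
  - by rewrite mulr_ge0 ?exprn_ge0 ?ler0n.
  - by rewrite mulr_ge0 ?exprn_ge0 ?ler0n.
  have := katz_koester z AS; rewrite -/m -/(f z) -/(g z) -/(B z) -/(e z) => kk.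
  rewrite -[leRHS]mulrA exprMn expr2 -mulrA ler_wpM2l ?exprn_ge0 ?ler0n //.
have hold : (\sum_(z <- Z) f z ^+ 2 * g z) ^+ 3 <= E3 ^+ 2 * G3.
  by apply: holder_sum => z; rewrite ler0n.
have E30 : 0 <= E3 by rewrite sumr_ge0 // => z _; rewrite exprn_ge0.
(* Cubing [cs] gives [E3 ^+ 3], and [hold] supplies the remaining [E3 ^+ 2 * G3]. *)
have -> : (Phi * m) ^+ 6 = ((Phi * m) ^+ 2) ^+ 3 by rewrite -exprM.
apply: le_trans (_ : ((\sum_(z <- Z) f z ^+ 2 * g z) * E3) ^+ 3 <= _).
  by rewrite lerXn2r ?nnegrE ?sqr_ge0 // (le_trans _ cs) ?sqr_ge0.
rewrite exprMn; have -> : E3 ^+ 5 * G3 = (E3 ^+ 2 * G3) * E3 ^+ 3 by ring.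
by rewrite ler_wpM2r ?exprn_ge0.
Qed.

End Energies.

(** * Popular levels and a lower bound for the multiplicative energy *)

Section Main.
Variable R : realType.
Implicit Types (A : {fset R}).

Lemma harmonic_ge1 N : (0 < N)%N -> 1 <= harmonic R N.
Proof.
move=> N0; rewrite /harmonic big_ltn // invr1 lerDl sumr_ge0 // => k _.
by rewrite invr_ge0.
Qed.

(** If every level fell below [E / (3 * harmonic R N)], [layer_cake] would give [E <= 2 / 3 * E];
    the 3 only has to exceed the 2 from the exponent. *)
Lemma popular_level (T : eqType) (s : seq T) (f : T -> nat) (N : nat) :
  {in s, forall x, f x <= N}%N -> (0 < N)%N -> 0 < \sum_(x <- s) (f x)%:R ^+ 2 :> R ->
  exists2 t, (0 < t)%N & \sum_(x <- s) (f x)%:R ^+ 2 <=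
    3 * (t%:R ^+ 2 * (\sum_(x <- s) (t <= f x))%N%:R) * harmonic R N.
Proof.
move=> fN N0; set E := \sum_(x <- s) _ => E0; have H1 := harmonic_ge1 N0.
apply: contrapT => no; have H0 : 0 < harmonic R N by apply: lt_le_trans H1.
have lev k : (0 < k)%N ->
    k%:R ^+ 2 * (\sum_(x <- s) (k <= f x))%N%:R <= E / (3 * harmonic R N).
  move=> k0; rewrite leNgt; apply/negP => lt; apply: no; exists k => //.
  move: lt; rewrite ltr_pdivrMr ?mulr_gt0 // => /ltW.
  by move=> /le_trans; apply; rewrite le_eqVlt; apply/orP; left; apply/eqP; ring.
have := layer_cake fN lev; rewrite -/E.
have -> : 2 * (E / (3 * harmonic R N)) * harmonic R N = 2 / 3 * E.
  by field; rewrite gt_eqF.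
lra.
Qed.

Lemma sum_sym (W : {fset R}) (g : R -> nat) : {in W, forall y, - y \in W} ->
  (\sum_(y <- W) g (- y)%R = \sum_(y <- W) g y)%N.
Proof.
move=> WN; rewrite -(big_map -%R xpredT g); apply: perm_big; apply: uniq_perm => //.
- by rewrite map_inj_uniq ?fset_uniq //; apply: oppr_inj.
- exact: fset_uniq.
move=> y; apply/mapP/idP => [[z zW ->]|yW]; first exact: WN.
by exists (- y); rewrite ?opprK ?WN.
Qed.

(** Collisions of [a * (b + c)] number at least [n ^ 6 / x]. Grouped by the ratio [l = a / a'] they
    are at most the sum of [quot A l * F l]; Cauchy-Schwarz separates the energy from the second
    moment of [F], which collinear triples control. *)
Lemma mult_energy_lower A N : {in A, forall a, 0 < a} -> (0 < #|` A| <= N)%N ->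
  #|` A|%:R ^+ 6 <= 1536 * #|` prod_sumset A|%:R ^+ 2 *
    (\sum_(l <- ratios A) (quot A l)%:R ^+ 2) * harmonic R N.
Proof.
move=> A0 /andP[nA AN]; set n : R := #|` A|%:R; set x : R := #|` prod_sumset A|%:R.
have n0 : 0 < n by rewrite ltr0n.
pose D := [fset l * c | l in ratios A, c in A].
pose W0 := [fset d - e | d in A, e in D].
(* Symmetric under negation, so that [2uv <= u^2 + v^2] bounds the products of incidences at [y] and
   [- y] by [F l]. *)
pose W := W0 `|` [fset - y | y in W0].
have WN : {in W, forall y, - y \in W}.
  move=> y; rewrite !inE => /orP[yW|/imfsetP[z /= zW ->]]; apply/orP.
    by right; apply/imfsetP; exists y.
  by left; rewrite opprK.
have WA l : l \in ratios A -> {in A &, forall c d, d - l * c \in W}.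
  move=> lA c d cA dA; rewrite inE; apply/orP; left; apply/imfset2P.
  by exists d => //; exists (l * c) => //; apply/imfset2P; exists l => //; exists c.
pose s := [seq (a, p) | a <- A, p <- [seq (b, c) | b <- A, c <- A]].
pose phi (t : R * (R * R)) := t.1 * (t.2.1 + t.2.2).
pose G l := (\sum_(b <- A) \sum_(c <- A) \sum_(b' <- A) \sum_(c' <- A)
  (l * (b + c) == b' + c')%R)%N.
pose F l := (\sum_(y <- W) inc A A (l, y) ^ 2)%N.
have GF l : l \in ratios A -> (G l <= F l)%N.
  move=> lA; apply: leq_trans (dilate_energy_le (WA l lA)) _.
  rewrite -(leq_pmul2l (_ : 0 < 2)%N) // big_distrr /= mul2n -addnn.
  have /= sy := sum_sym (fun y => inc A A (l, y) ^ 2)%N WN.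
  rewrite {1}/F -{1}sy /F -big_split /=.
  by apply: leq_sum => y _; rewrite nat_Cauchy.
pose E6 := (\sum_(i <- s) \sum_(j <- s) (phi i == phi j))%N.
have E6F : (E6 <= \sum_(l <- ratios A) quot A l * F l)%N.
  apply: leq_trans (_ : \sum_(l <- ratios A) quot A l * G l <= _)%N; last first.
    rewrite big_seq [leqRHS]big_seq; apply: leq_sum => l lA.
    by rewrite leq_mul2l GF ?orbT.
  apply: leq_trans (sum_ratios G A0).
  rewrite /E6 /s big_allpairs_dep big_seq [leqRHS]big_seq; apply: leq_sum => a aA.
  under eq_bigr => p _ do rewrite big_allpairs_dep.
  rewrite exchange_big /= big_seq [leqRHS]big_seq; apply: leq_sum => a' a'A.
  rewrite /G big_allpairs_dep; apply: leq_sum => b _; apply: leq_sum => c _.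
  rewrite big_allpairs_dep; apply: leq_sum => b' _; apply: leq_sum => c' _.
  rewrite /phi /=; case: eqP => // e; have a'0 := A0 _ a'A.
  have -> // : a / a' * (b + c) == b' + c'.
  by rewrite mulrAC e mulrAC mulfV ?mul1r // gt_eqF.
have col : n ^+ 6 <= x * E6%:R.
  have := @collision_bound R _ _ s phi (prod_sumset A) _.
  rewrite !size_allpairs !natrM -/n -/x -/E6 => h.
  have -> : n ^+ 6 = (n * (n * n)) ^+ 2 by ring.
  apply: h => i /allpairsP[[a p] /= [aA /allpairsP[[b c] /= [bA cA ->]] ->]].
  rewrite /phi /=; apply/imfset2P; exists a => //; exists (b + c) => //.
  by apply/imfset2P; exists b => //; exists c.
pose M3 l : R := \sum_(y <- W) (inc A A (l, y))%:R ^+ 3.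
have M30 l : 0 <= M3 l by apply: sumr_ge0 => y _; rewrite exprn_ge0.
(* The second moment lies between the first, at most [n ^ 2], and the third. *)
have FM l : l \in ratios A -> (F l)%:R ^+ 2 <= n ^+ 2 * M3 l.
  move=> lA; apply: le_trans (_ : (\sum_(y <- W) (inc A A (l, y))%:R) * M3 l <= _).
    rewrite /F natr_sum; apply: cauchy_schwarz_sum => y //; rewrite ?exprn_ge0 //.
    by rewrite natrX -exprM -exprS.
  rewrite ler_wpM2r // -natr_sum /n -natrX ler_nat -mulnn.
  by apply: sum_inc_le; rewrite gt_eqF // (ratios_gt0 A0).
set Q : R := \sum_(l <- ratios A) _; set H := harmonic R N.
have Q0 : 0 <= Q by apply: sumr_ge0 => l _; rewrite exprn_ge0.
have E62 : E6%:R ^+ 2 <= Q * (n ^+ 2 * (1536 * n ^+ 4 * H)).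
  apply: le_trans (_ : (\sum_(l <- ratios A) (quot A l)%:R * (F l)%:R) ^+ 2 <= _).
    rewrite lerXn2r ?nnegrE ?sumr_ge0 // => [l _|]; first by rewrite mulr_ge0.
    by rewrite -[leRHS](_ : (\sum_(l <- ratios A) quot A l * F l)%N%:R = _) ?ler_nat // natr_sum;
       apply: eq_bigr => l _; rewrite natrM.
  apply: le_trans (_ : Q * (\sum_(l <- ratios A) (F l)%:R ^+ 2) <= _).
    apply: cauchy_schwarz_sum => l; rewrite ?exprn_ge0 ?mulr_ge0 //.
    by rewrite exprMn.
  rewrite ler_wpM2l //.
  apply: le_trans (_ : n ^+ 2 * \sum_(l <- ratios A) M3 l <= _).
    by rewrite big_distrr /= big_seq [leRHS]big_seq; apply: ler_sum => l /FM.
  rewrite ler_wpM2l ?exprn_ge0 ?ler0n //.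
  by apply: inc_third_moment => //; [apply: ratios_gt0 | apply: card_ratios].
have x0 : 0 <= x by rewrite ler0n.
rewrite -(ler_pM2r (_ : 0 < n ^+ 6)) ?exprn_gt0 //.
apply: le_trans (_ : (x * E6%:R) ^+ 2 <= _).
  by rewrite -expr2 lerXn2r ?nnegrE ?mulr_ge0 ?exprn_ge0 // ltW.
rewrite exprMn.
have -> : 1536 * x ^+ 2 * Q * H * n ^+ 6 = x ^+ 2 * (Q * (n ^+ 2 * (1536 * n ^+ 4 * H))) by ring.
by rewrite ler_wpM2l ?exprn_ge0.
Qed.

End Main.

(** Eliminates [m], [t] and [p]: these enter only through [w = t ^+ 2 * p], bounded above by [h4]
    and below by the energy bound [hn]. *)
Lemma combine_bounds (R : realFieldType) (n x m t p H Phi E3 G3 c0 c1 c2 : R) :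
  0 < n -> 0 < x -> 0 < m -> 0 < t -> 0 < p -> 0 < H -> 0 <= Phi -> 0 <= E3 -> 0 <= G3 ->
  0 < c0 -> 0 < c1 -> 0 < c2 ->
  n ^+ 6 <= c0 * x ^+ 2 * (t ^+ 2 * p) * H ^+ 2 -> t <= 2 * m -> t * p <= 2 * m * n ->
  m ^+ 4 <= x * Phi -> (Phi * m) ^+ 6 <= E3 ^+ 5 * G3 ->
  E3 <= c1 * (n ^+ 5 * m ^+ 2 / (p * t ^+ 3)) * H -> G3 <= c2 * (x ^+ 4 / n) * H ->
  n ^+ 137 <= c0 ^+ 35 * (2 ^+ 40 * (c1 ^+ 5 * c2) ^+ 2) * x ^+ 90 * H ^+ 82.
Proof.
move=> n0 x0 m0 t0 p0 H0 Phi0 E30 G30 c00 c10 c20 hn htm htp hPhi hmom hE3 hG3.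
set K := c1 ^+ 5 * c2; have K0 : 0 < K by rewrite mulr_gt0 ?exprn_gt0.
pose w := t ^+ 2 * p; have w0 : 0 < w by rewrite mulr_gt0 ?exprn_gt0.
have lexp (a b : R) k : 0 <= a -> a <= b -> a ^+ k <= b ^+ k.
  by move=> a0 ab; rewrite lerXn2r ?nnegrE // (le_trans a0).
have h1 : m ^+ 20 * w ^+ 5 * t ^+ 5 <= K * x ^+ 10 * n ^+ 24 * H ^+ 6.
  have pt0 : 0 < p * t ^+ 3 by rewrite mulr_gt0 ?exprn_gt0.
  have a1 : (m ^+ 5) ^+ 6 <= x ^+ 6 * (E3 ^+ 5 * G3).
    apply: le_trans (_ : (x * (Phi * m)) ^+ 6 <= _).
      apply: lexp; rewrite ?exprn_ge0 ?(ltW m0) //.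
      by rewrite exprSr mulrA ler_wpM2r ?(ltW m0).
    by rewrite exprMn ler_wpM2l // exprn_ge0 // ltW.
  have a2 : E3 ^+ 5 * G3 <= (c1 * (n ^+ 5 * m ^+ 2 / (p * t ^+ 3)) * H) ^+ 5 * (c2 * (x ^+ 4 / n) * H).
    by apply: ler_pM; rewrite ?exprn_ge0 // lexp.
  have a3 : (m ^+ 5) ^+ 6 <= x ^+ 6 *
      ((c1 * (n ^+ 5 * m ^+ 2 / (p * t ^+ 3)) * H) ^+ 5 * (c2 * (x ^+ 4 / n) * H)).
    by apply: le_trans a1 _; rewrite ler_wpM2l // exprn_ge0 // ltW.
  have s0 : 0 < (p * t ^+ 3) ^+ 5 / m ^+ 10 by rewrite divr_gt0 ?exprn_gt0.
  move: a3; rewrite -(ler_pM2r s0); congr (_ <= _).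
    by rewrite /w; field; rewrite gt_eqF.
  by rewrite /K; field; rewrite !gt_eqF.
have h2 : w <= 2 * n * (m * t).
  have -> : w = t * (t * p) by rewrite /w; ring.
  have -> : 2 * n * (m * t) = t * (2 * m * n) by ring.
  by rewrite ler_pM2l.
have h3 : w <= 4 * n * m ^+ 2.
  apply: le_trans h2 _.
  have -> : 4 * n * m ^+ 2 = 2 * n * (m * (2 * m)) by ring.
  by rewrite !ler_pM2l // mulr_gt0.
have h4 : w ^+ 35 <= 2 ^+ 40 * K ^+ 2 * x ^+ 20 * n ^+ 73 * H ^+ 12.
  (* Ten factors are kept, ten use [h2] and fifteen [h3]: the powers of [m], [w] and [t] then form
     exactly the square of the left side of [h1]. *)
  have -> : w ^+ 35 = w ^+ 10 * (w ^+ 10 * w ^+ 15) by rewrite -!exprD.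
  apply: le_trans (_ : w ^+ 10 * ((2 * n * (m * t)) ^+ 10 * (4 * n * m ^+ 2) ^+ 15) <= _).
    rewrite ler_wpM2l ?exprn_ge0 ?(ltW w0) //.
    by apply: ler_pM; rewrite ?exprn_ge0 ?(ltW w0) // lexp // ltW.
  have -> : w ^+ 10 * ((2 * n * (m * t)) ^+ 10 * (4 * n * m ^+ 2) ^+ 15) =
     2 ^+ 40 * n ^+ 25 * (m ^+ 20 * w ^+ 5 * t ^+ 5) ^+ 2 by ring.
  have -> : 2 ^+ 40 * K ^+ 2 * x ^+ 20 * n ^+ 73 * H ^+ 12 =
     2 ^+ 40 * n ^+ 25 * (K * x ^+ 10 * n ^+ 24 * H ^+ 6) ^+ 2 by ring.
  rewrite ler_wpM2l ?mulr_ge0 ?exprn_ge0 ?(ltW n0) //.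
  by apply: lexp h1; rewrite !mulr_ge0 ?exprn_ge0 // ltW.
rewrite -(ler_pM2r (_ : 0 < n ^+ 73)) ?exprn_gt0 //.
have -> : n ^+ 137 * n ^+ 73 = (n ^+ 6) ^+ 35 by rewrite -exprD -exprM.
apply: le_trans (_ : (c0 * x ^+ 2 * w * H ^+ 2) ^+ 35 <= _).
  by apply: lexp; rewrite ?exprn_ge0 // ltW.
have -> : (c0 * x ^+ 2 * w * H ^+ 2) ^+ 35 = c0 ^+ 35 * x ^+ 70 * H ^+ 70 * w ^+ 35.
  have sq y : y ^+ 70 = (y ^+ 2) ^+ 35 :> R by rewrite -exprM.
  by rewrite !sq; move: (x ^+ 2) (H ^+ 2) => a b; rewrite !exprMn mulrAC.
apply: le_trans (_ : c0 ^+ 35 * x ^+ 70 * H ^+ 70 *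
    (2 ^+ 40 * K ^+ 2 * x ^+ 20 * n ^+ 73 * H ^+ 12) <= _).
  by rewrite ler_wpM2l ?mulr_ge0 ?exprn_ge0 // ltW.
have -> : x ^+ 90 = x ^+ 70 * x ^+ 20 by rewrite -exprD.
have -> : H ^+ 82 = H ^+ 70 * H ^+ 12 by rewrite -exprD.
rewrite le_eqVlt; apply/orP; left; apply/eqP.
move: (x ^+ 70) (x ^+ 20) (H ^+ 70) (H ^+ 12) (n ^+ 73) (c0 ^+ 35) (K ^+ 2) (2 ^+ 40).
by move=> *; ring.
Qed.

(** * The bound for sets of positive reals *)

Section Positive.
Variable R : realType.
Implicit Types (A S Z : {fset R}).

Lemma prod_sumset_mem A a b c : a \in A -> b \in A -> c \in A ->
  a * (b + c) \in prod_sumset A.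
Proof.
move=> aA bA cA; apply/imfset2P; exists a => //; exists (b + c) => //.
by apply/imfset2P; exists b => //; exists c.
Qed.

(** Multiplication by [a] injects the sumset into the product set. *)
Lemma card_sumset_le A a : a \in A -> a != 0 -> (#|` sumset A| <= #|` prod_sumset A|)%N.
Proof.
move=> aA a0.
rewrite card_fset_sum1 big_seq.
apply: leq_trans (_ : \sum_(s <- sumset A) ((a * s)%R \in prod_sumset A) <= _)%N.
  rewrite [leqRHS]big_seq; apply: leq_sum => s /imfset2P[b /= bA [c /= cA ->]].
  by rewrite prod_sumset_mem.
by apply: sum_mem_le => s s' _ _ /mulfI; apply.
Qed.

Lemma card_le_sumset A : (#|` A| <= #|` sumset A|)%N.
Proof.
have [->|[a aA]] := fset_0Vmem A; first by rewrite cardfs0.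
rewrite card_fset_sum1 big_seq.
apply: leq_trans (_ : \sum_(b <- A) ((a + b)%R \in sumset A) <= _)%N.
  rewrite [leqRHS]big_seq; apply: leq_sum => b bA.
  by have -> // : a + b \in sumset A by apply/imfset2P; exists a => //; exists b.
by apply: sum_mem_le => s s' _ _ /addrI.
Qed.

(* Every element of [sumset A] is [w / a] with [w] in [prod_sumset A], in [#|A|] ways. *)
Lemma sumset_third_moment A Z : {in A, forall a, 0 < a} -> (0 < #|` A|)%N ->
  \sum_(z <- Z) (rep (sumset A) (sumset A) z)%:R ^+ 3 <=
  1536 * (#|` prod_sumset A|%:R ^+ 4 / #|` A|%:R) * harmonic R #|` prod_sumset A|.
Proof.
move=> A0 nA; set n : R := #|` A|%:R; set x : R := #|` prod_sumset A|%:R.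
have n0 : 0 < n by rewrite ltr0n.
have [a0 a0A] := fset0Pn _ (etrans (esym (cardfs_gt0 A)) nA).
have Sx := card_sumset_le a0A (lt0r_neq0 (A0 _ a0A)); have nS := card_le_sumset A.
(* Dividing by [a^-1] multiplies by [a], so every slope of [L] sends every sum into
   [prod_sumset A]. *)
pose L := [fset a^-1 | a in A].
have cL : #|` L| = #|` A| by apply: card_imfset => ? ?; apply: invr_inj.
have L0 : {in L, forall l, 0 < l} by move=> l /imfsetP[a /= aA ->]; rewrite invr_gt0 A0.
have deg : {in sumset A, forall s, n <= (\sum_(l <- L) (s / l \in prod_sumset A)%R)%N%:R}.
  move=> s /imfset2P[b /= bA [c /= cA ->]]; rewrite ler_nat -cL card_fset_sum1.
  rewrite big_seq [leqRHS]big_seq; apply: leq_sum => l /imfsetP[a /= aA ->].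
  by rewrite invrK mulrC prod_sumset_mem.
have nx : n <= x by rewrite ler_nat (leq_trans nS).
apply: le_trans (rep_third_moment (sumset A) Z L0 n0 nx deg Sx Sx) _.
rewrite cL -/n -/x ler_wpM2r ?harmonic_ge0 // ler_pM2l //.
have -> : x ^+ 4 / n = x ^+ 2 * x ^+ 2 * n ^+ 2 / n ^+ 3 by field; rewrite gt_eqF.
rewrite !ler_pM2r ?invr_gt0 ?exprn_gt0 // ler_wpM2l ?exprn_ge0 ?ler0n //.
by rewrite lerXn2r ?nnegrE ?ler0n // ler_nat.
Qed.

(** The additive energy of [A], bounded below by collisions of addition into [S]. *)
Lemma energy_lower A S Z : {in A &, forall a b, a + b \in S} ->
  {in A &, forall a c, a - c \in Z} ->
  #|` A|%:R ^+ 4 <= #|` S|%:R * \sum_(z <- Z) (rep A A z)%:R ^+ 2 :> R.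
Proof.
move=> AS AZ; pose s := [seq (a, b) | a <- A, b <- A].
have := @collision_bound R _ _ s (fun p => p.1 + p.2) S.
rewrite size_allpairs natrM -expr2 -exprM => h; apply: le_trans (h _) _.
  by move=> i /allpairsP[[a b] /= [aA bA ->]] /=; apply: AS.
rewrite ler_wpM2l //.
have -> : \sum_(z <- Z) (rep A A z)%:R ^+ 2 = (\sum_(z <- Z) rep A A z * rep A A z)%N%:R :> R.
  by rewrite natr_sum; apply: eq_bigr => z _; rewrite natrM expr2.
rewrite ler_nat; apply: leq_trans (add_energy_le A AZ).
rewrite big_allpairs_dep; apply: leq_sum => a _; apply: leq_sum => b _.
by rewrite big_allpairs_dep.
Qed.

Lemma expander_positive : exists2 C : R, 0 < C & forall A, {in A, forall a, 0 < a} ->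
  (0 < #|` A|)%N -> #|` A|%:R ^+ 137 <=
    C * #|` prod_sumset A|%:R ^+ 90 * harmonic R #|` prod_sumset A| ^+ 82.
Proof.
(* The 3 comes from [popular_level]; the 8 below is the cube of the 2 in the denominator of [q]. *)
have c0 : 0 < 3 * 1536 :> R := mulr_gt0 (ltr0Sn R 2) (ltr0Sn R 1535).
have c1 : 0 < 8 * 1536 :> R := mulr_gt0 (ltr0Sn R 7) (ltr0Sn R 1535).
exists ((3 * 1536) ^+ 35 * (2 ^+ 40 * ((8 * 1536) ^+ 5 * 1536) ^+ 2)).
  exact: mulr_gt0 (exprn_gt0 _ c0) (mulr_gt0 (exprn_gt0 _ (ltr0Sn R 1))
    (exprn_gt0 _ (mulr_gt0 (exprn_gt0 _ c1) (ltr0Sn R 1535)))).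
move=> A A0 nA; set N := #|` prod_sumset A|.
have [a0 a0A] := fset0Pn _ (etrans (esym (cardfs_gt0 A)) nA).
have SN := card_sumset_le a0A (lt0r_neq0 (A0 _ a0A)); have AN := leq_trans (card_le_sumset A) SN.
have N0 := leq_trans nA AN; have H1 := harmonic_ge1 R N0.
set H := harmonic R N in H1 *; have H0 : 0 < H by apply: lt_le_trans H1.
set n : R := #|` A|%:R; have n0 : 0 < n by rewrite ltr0n.
set x : R := N%:R; have x0 : 0 < x by rewrite ltr0n.
have := @mult_energy_lower R A N A0; rewrite nA AN => /(_ isT).
rewrite -/n -/x -/H; set Q := \sum_(l <- ratios A) _ => hQ.
have Q0 : 0 < Q.
  rewrite lt_neqAle sumr_ge0 ?andbT => [|l _]; last by rewrite exprn_ge0.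
  apply/eqP => Q0; move: hQ; rewrite -Q0 mulr0 mul0r leNgt exprn_gt0 //.
have quotN : {in ratios A, forall l, quot A l <= N}%N.
  move=> l _; apply: leq_trans AN; rewrite card_fset_sum1.
  by apply: leq_sum => a _; case: (_ \in _).
have [t t0' ht] := popular_level quotN N0 Q0.
pose P := [fset l in ratios A | (t <= quot A l)%N].
rewrite -card_filter -/P -/Q -/H in ht; set t' : R := t%:R in ht; set p : R := #|` P|%:R in ht.
have t0 : 0 < t' by rewrite ltr0n.
have p0 : 0 < p.
  rewrite lt_neqAle ler0n andbT; apply/eqP => p0.
  by move: ht; rewrite -p0 mulr0 mulr0 mul0r leNgt Q0.
pose deg a := (\sum_(l <- P) (a / l \in A)%R)%N.
have degE : (\sum_(a <- A) deg a = \sum_(l <- P) quot A l)%N by rewrite exchange_big.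
have deg_lb : t' * p <= (\sum_(a <- A) deg a)%N%:R.
  rewrite degE -natrM ler_nat mulnC card_fset_sum1 big_distrl /= big_seq [leqRHS]big_seq.
  by apply: leq_sum => l; rewrite !inE mul1n => /andP[].
have deg_ub : t' * p <= n ^+ 2.
  apply: le_trans deg_lb _; rewrite degE -natrX ler_nat.
  apply: leq_trans (sum_quot_le A0); rewrite /P big_fset /= big_mkcond /=.
  by apply: leq_sum => l _; case: ifP.
(* Half of a lower bound for the average degree: elements of degree below [q] carry at most [n * q],
   half of [t' * p], so [B] keeps the other half. *)
pose q := t' * p / (2 * n).
have q0 : 0 < q by rewrite divr_gt0 ?mulr_gt0.
have qn : q <= n by rewrite ler_pdivrMr ?mulr_gt0 //; nra.
pose B := [fset a in A | q <= (deg a)%:R]; set m : R := #|` B|%:R.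
have BA : (#|` B| <= #|` A|)%N.
  by rewrite card_filter card_fset_sum1; apply: leq_sum => a _; case: (_ <= _).
have degB : t' * p <= 2 * (\sum_(a <- B) deg a)%N%:R.
  have : (\sum_(a <- A) deg a)%N%:R <= (\sum_(a <- B) deg a)%N%:R + n * q.
    rewrite /n card_fset_sum1 !natr_sum big_distrl /B big_fset /= [in leRHS]big_mkcond /= -big_split /=.
    apply: ler_sum => a _; rewrite mul1r; case: ifP => [_|/negbT]; first by rewrite lerDl ltW.
    by rewrite -ltNge add0r => /ltW.
  have -> : n * q = t' * p / 2 by rewrite /q; field; rewrite gt_eqF.
  lra.
(* Degrees in [B] are at most [p]; for [tpm] below they are at most [n]. *)
have tm : t' <= 2 * m.
  rewrite -(ler_pM2r p0); apply: le_trans degB _; rewrite -mulrA ler_pM2l // -natrM ler_nat.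
  rewrite card_fset_sum1 big_distrl /=; apply: leq_sum => a _.
  by rewrite mul1n card_fset_sum1; apply: leq_sum => l _; case: (_ \in _).
have tpm : t' * p <= 2 * m * n.
  apply: le_trans degB _; rewrite -mulrA ler_pM2l // -natrM ler_nat.
  rewrite [#|` B|]card_fset_sum1 big_distrl /= big_seq [leqRHS]big_seq; apply: leq_sum => a.
  rewrite !inE => /andP[aA _]; rewrite mul1n; apply: sum_mem_le => l l' _ _ /mulfI.
  by move=> /(_ (negbT (gt_eqF (A0 _ aA)))) /invr_inj.
have m0 : 0 < m by rewrite -(pmulr_rgt0 _ (_ : 0 < 2)) // (lt_le_trans t0).
pose Z := differences B.
have BZ : {in B &, forall a c, a - c \in Z}.
  by move=> a c aB cB; apply/imfset2P; exists a => //; exists c.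
have BS : {in B &, forall a b, a + b \in sumset A}.
  move=> a b; rewrite !inE => /andP[aA _] /andP[bA _].
  by apply/imfset2P; exists a => //; exists b.
have P0 : {in P, forall l, 0 < l}.
  by move=> l; rewrite !inE => /andP[lA _]; apply: (ratios_gt0 A0).
have Bdeg : {in B, forall a, q <= (\sum_(l <- P) (a / l \in A)%R)%N%:R}.
  by move=> a; rewrite !inE => /andP[].
have hE3 := rep_third_moment B Z P0 q0 qn Bdeg BA (leq_trans BA AN).
have hG3 := sumset_third_moment Z A0 nA.
have hmom := energy_third_moments BS BZ.
have hPhi := energy_lower BS BZ.
rewrite -/m -/n -/p -/x -/H -/N in hE3 hG3 hmom hPhi.
set E3 := \sum_(z <- Z) _ ^+ 3 in hE3 hmom.
set G3 := \sum_(z <- Z) _ in hG3 hmom.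
set Phi := \sum_(z <- Z) _ in hPhi hmom.
have Phi0 : 0 <= Phi by apply: sumr_ge0 => z _; rewrite exprn_ge0.
have E30 : 0 <= E3 by apply: sumr_ge0 => z _; rewrite exprn_ge0.
have G30 : 0 <= G3 by apply: sumr_ge0 => z _; rewrite exprn_ge0.
apply: (combine_bounds n0 x0 m0 t0 p0 H0 Phi0 E30 G30 c0 c1 (ltr0Sn R 1535)) => //.
- apply: le_trans hQ _; have -> : 3 * 1536 * x ^+ 2 * (t' ^+ 2 * p) * H ^+ 2 =
    1536 * x ^+ 2 * (3 * (t' ^+ 2 * p) * H) * H by ring.
  by rewrite ler_wpM2r ?(ltW H0) // ler_wpM2l // mulr_ge0 ?exprn_ge0 ?(ltW x0).
- by apply: le_trans hPhi _; rewrite ler_wpM2r // ler_nat.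
apply: le_trans hE3 _; rewrite le_eqVlt; apply/orP; left; apply/eqP.
by rewrite /q; field; rewrite !gt_eqF.
Qed.

End Positive.

(** * Harmonic sums, and reduction to positive sets *)

Section Reduction.
Variable R : realType.
Implicit Types (A B : {fset R}).

(** Induction, with [ln (1 - y) <= - y] at [y = N.+2%:R^-1]. *)
Lemma harmonic_le_ln N : (0 < N)%N -> harmonic R N <= 1 + ln N%:R.
Proof.
case: N => // N _; elim: N => [|N IH].
  by rewrite /harmonic big_nat1 invr1 ln1 addr0.
rewrite /harmonic big_nat_recr //= -/(harmonic R N.+1).
have N1 : 0 < N.+1%:R :> R by rewrite ltr0n.
have N2 : 0 < N.+2%:R :> R by rewrite ltr0n.
have step : ln (1 - N.+2%:R^-1) <= - N.+2%:R^-1 :> R.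
  by apply: le_ln1Dx; rewrite ltrN2 invf_lt1 // ltr1n.
have e : 1 - N.+2%:R^-1 = N.+1%:R / N.+2%:R :> R.
  have e2 : N.+2%:R = N.+1%:R + 1 :> R by rewrite natr1.
  by move: N2; rewrite e2; move: N.+1%:R => k k0; field; rewrite gt_eqF.
move: step IH; rewrite e ln_div ?posrE //.
by move: (ln _) (ln _) (_^-1) (harmonic _ _) => a b c h; lra.
Qed.

Lemma le_harmonic M N : (M <= N)%N -> harmonic R M <= harmonic R N.
Proof.
move=> MN; rewrite /harmonic [leRHS](@big_cat_nat _ _ _ M.+1) //= lerDl.
by apply: sumr_ge0 => k _; rewrite invr_ge0.
Qed.

(** [B] is the larger of the positive part and the negated negative part; negating all three
    variables preserves [a * (b + c)]. The element 0 costs one more, and [2 * #|B| + 1 <= 3 * #|B|]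
    since [B] is nonempty. *)
Lemma positive_part A : (2 <= #|` A|)%N -> exists B,
  [/\ {in B, forall b, 0 < b}, (#|` A| <= 3 * #|` B|)%N & prod_sumset B `<=` prod_sumset A].
Proof.
move=> A2; pose P := [fset a in A | 0 < a]; pose M := [fset a in A | a < 0].
have cA : (#|` A| <= #|` P| + #|` M| + 1)%N.
  rewrite !card_filter card_fset_sum1.
  apply: leq_trans (leq_add (leqnn _) (leq_b1 (0 \in A))).
  rewrite -sum_eq_mem -!big_split /=; apply: leq_sum => a _.
  by case: (ltgtP a 0).
have [PM|MP] := leqP #|` M| #|` P|.
  exists P; split; first by move=> b; rewrite !inE => /andP[].
    by move: cA A2 PM; move: #|` A| #|` P| #|` M| => u v w; lia.
  apply/fsubsetP => y /imfset2P[a /= aP [s /= /imfset2P[b /= bP [c /= cP ->]] ->]].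
  by move: aP bP cP; rewrite !inE => /andP[aA _] /andP[bA _] /andP[cA' _]; apply: prod_sumset_mem.
exists [fset - a | a in M]; split.
- by move=> b /imfsetP[a /= aM ->]; move: aM; rewrite !inE oppr_gt0 => /andP[].
- by rewrite card_imfset; [move: cA A2 MP; move: #|` A| #|` P| #|` M| => u v w; lia | exact: oppr_inj].
apply/fsubsetP => y /imfset2P[a /= /imfsetP[a' /= aM ->] [s /= /imfset2P[b /=]]].
move=> /imfsetP[b' /= bM ->] [c /= /imfsetP[c' /= cM ->]] -> ->.
rewrite -opprD mulrNN; move: aM bM cM; rewrite !inE.
by move=> /andP[aA _] /andP[bA _] /andP[cA' _]; apply: prod_sumset_mem.
Qed.

Lemma card_le_prod_sumset A : (2 <= #|` A|)%N -> (#|` A| <= #|` prod_sumset A|)%N.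
Proof.
move=> A2; have : (0 < #|` A `\ 0%R|)%N.
  by move: A2; rewrite (cardfsD1 0 A); case: (0 \in A); [rewrite add1n ltnS | apply: ltnW].
rewrite cardfs_gt0 => /fset0Pn[a]; rewrite !inE => /andP[a0 aA].
exact: leq_trans (card_le_sumset A) (card_sumset_le aA a0).
Qed.

End Reduction.

Local Open Scope fset_scope.

(* |A(A+A)| >~ |A|^(3/2 + 5/242): there are absolute constants K, c > 0 with
   |A|^(3/2+5/242) / (log2 |A(A+A)|)^c <= K * |A(A+A)| for every finite A
   with |A| >= 2 (for |A| <= 1 the log is 0 / the statement is degenerate). *)
Theorem theorem1p2 (R : realType) :
  exists K c : R, 0 < K /\ 0 < c /\
    forall A : {fset R}, (2 <= #|` A|)%N ->
      (#|` A|%:R `^ (3 / 2 + 5 / 242)) / (log2 (#|` prod_sumset A|%:R) `^ c)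
        <= K * #|` prod_sumset A|%:R.
Proof.
have [C C0 hC] := expander_positive R.
(* The 3 is the loss in [positive_part], the 2 that in [HL]. *)
have [a a0 aE] : exists2 a : R, (0 < a)%R & a = (3 ^+ 137 * C * 2 ^+ 82)%R.
  exists (3 ^+ 137 * C * 2 ^+ 82)%R => [|//].
  exact: mulr_gt0 (mulr_gt0 (exprn_gt0 _ (ltr0Sn R 2)) C0) (exprn_gt0 _ (ltr0Sn R 1)).
pose D := (a + 1)%R.
have D1 : (1 <= D)%R by rewrite lerDr ltW.
have D0 : (0 < D)%R by apply: lt_le_trans D1.
(* As [1 <= D], [D ^+ 90] dominates [a] and no 90th root is taken. The exponent 1 on the logarithm
   suffices because [L ^+ 82 <= L ^+ 90]. *)
exists D, 1%R; split => //; split => // A A2.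
have [B [B0 AB sub]] := positive_part A2.
have xx : (#|` prod_sumset B| <= #|` prod_sumset A|)%N by apply: fsubset_leq_card.
have nx := card_le_prod_sumset A2.
set n : R := #|` A|%:R; set x : R := #|` prod_sumset A|%:R.
have n1 : (1 <= n)%R by rewrite ler1n; apply: leq_trans A2.
have n0 : (0 <= n)%R by apply: le_trans n1.
have x2 : (2 <= x)%R by rewrite (ler_nat R 2) (leq_trans A2).
have x0 : (0 <= x)%R by apply: le_trans x2.
have l2 : (0 < ln 2 :> R)%R by rewrite ln_gt0 // ltr1n.
have l2' : (ln 2 <= 1 :> R)%R by apply: (@le_ln1Dx R 1); rewrite (@lt_trans _ _ 0) ?ltrN10.
set L := log2 x.
have L1 : (1 <= L)%R by rewrite /L /log2 ler_pdivlMr // mul1r ler_ln ?posrE // (lt_le_trans _ x2).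
have L0 : (0 <= L)%R by apply: le_trans L1.
set H := harmonic R #|` prod_sumset A|.
have HL : (H <= 2 * L)%R.
  apply: le_trans (harmonic_le_ln R _) _; first by apply: leq_trans nx; apply: leq_trans A2.
  have -> : ln #|` prod_sumset A|%:R = (L * ln 2)%R :> R by rewrite /L /log2 divfK ?gt_eqF.
  by nra.
clearbody L.
have key : (n ^+ 137 <= (D * (x * L)) ^+ 90)%R.
  have nB : (n <= 3 * #|` B|%:R)%R by rewrite -natrM ler_nat.
  apply: le_trans (_ : (3 * #|` B|%:R) ^+ 137 <= _)%R.
    by rewrite lerXn2r ?nnegrE ?mulr_ge0.
  have B1 : (0 < #|` B|)%N.
    by rewrite lt0n; apply/eqP => B00; move: (leq_trans A2 AB); rewrite B00.
  rewrite exprMn; apply: le_trans (_ : 3 ^+ 137 * (C * x ^+ 90 * (2 * L) ^+ 82) <= _)%R.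
    rewrite ler_pM2l ?exprn_gt0 //; apply: le_trans (hC B B0 B1) _.
    have hB : (harmonic R #|` prod_sumset B| <= 2 * L)%R.
      by apply: le_trans HL; apply: le_harmonic.
    apply: ler_pM; rewrite ?mulr_ge0 ?exprn_ge0 ?harmonic_ge0 ?(ltW C0) //.
      by rewrite ler_pM2l // lerXn2r ?nnegrE ?ler0n // ler_nat.
    by rewrite lerXn2r ?nnegrE ?harmonic_ge0 ?mulr_ge0.
  have L82 : (L ^+ 82 <= L ^+ 90)%R by rewrite ler_weXn2l.
  have D90 : (a <= D ^+ 90)%R.
    apply: le_trans (_ : D <= _)%R; first by rewrite lerDl.
    by rewrite -{1}[D]expr1 ler_weXn2l.
  rewrite !exprMn.
  have -> : (3 ^+ 137 * (C * x ^+ 90 * (2 ^+ 82 * L ^+ 82)) =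
    a * (x ^+ 90 * L ^+ 82))%R.
    by rewrite aE; move: (3 ^+ 137)%R (2 ^+ 82)%R (x ^+ 90)%R (L ^+ 82)%R => *; ring.
  by apply: ler_pM; rewrite ?mulr_ge0 ?exprn_ge0 ?(ltW a0) // ler_wpM2l ?exprn_ge0.
rewrite powRr1 // ler_pdivrMr ?(lt_le_trans _ L1) // -mulrA.
(* Since [1 <= n] and [3 / 2 + 5 / 242 <= 137 / 90], the exponent may be raised; taking 90th powers
   then reduces the goal to [key]. *)
apply: le_trans (_ : n `^ (137%:R / 90%:R) <= _)%R.
  by apply: ler_powR => //; lra.
have DxL : (0 <= D * (x * L))%R by rewrite !mulr_ge0 ?(ltW D0).
rewrite -(ler_pXn2r (_ : 0 < 90)%N) ?nnegrE ?powR_ge0 //.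
by rewrite -powR_mulrn ?powR_ge0 // -powRrM divfK ?pnatr_eq0 // powR_mulrn.
Qed.
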